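(* Let $V$ be a real Hilbert space, $V_h\subset V$ a finite-dimensional subspace, $a:V\times V\to\mathbb{R}$ a bounded and inf-sup stable bilinear form with induced operator $A:V\to V^*$, and $f\in V^*$. Let $u\in V$ satisfy $a(u,v)=f(v)$ for all $v\in V$ and let $u_h\in V_h$ satisfy $a(u_h,v_h)=f(v_h)$ for all $v_h\in V_h$. Let $\|\cdot\|_M$ be a norm on $V$. Let $B:V^*\to V$ be a (linear) contractive iterator with respect to the $M$-norm, i.e. $$\|I-BA\|_M<1 .$$ Then with $r=f-Au_h\in V^*$, we have $$\frac12\|Br\|_M<\|u-u_h\|_M\le\frac{\|Br\|_M}{1-\|I-BA\|_M}.$$
   Context: $V^*$ is the dual space of $V$ and $\langle\cdot,\cdot\rangle$ the duality pairing. The operator $A:V\to V^*$ is defined by $(Av)(w)=\langle Av,w\rangle:=a(v,w)$ for $v,w\in V$. ''Inf-sup stable'' is understood in the usual sense that $A$ is an isomorphism from $V$ onto $V^*$ (so the problem $Au=f$ is well posed). $B$ is called an iterator because it defines the linear iterative solver $u_{n+1}=u_n+B(f-Au_n)$, $n=0,1,2,\dots$, for $Au=f$. For a linear map $T:V\to V$, $\|T\|_M:=\sup_{0\neq v\in V}\|Tv\|_M/\|v\|_M$ is the operator norm induced by $\|\cdot\|_M$; $I$ is the identity on $V$.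
   Formalization: The strict lower bound is stated only for u ≠ u_h, since for u = u_h both sides are 0 and the strict inequality fails; the upper bound is stated without this restriction. *)

(* Defs.v *)
From HB Require Import structures.
From mathcomp Require Import all_boot all_order all_algebra.
From mathcomp Require Import all_classical all_reals all_analysis.

Set Implicit Arguments.
Unset Strict Implicit.
Unset Printing Implicit Defensive.

Import Order.TTheory GRing.Theory Num.Theory.
Import numFieldNormedType.Exports.

Local Open Scope classical_set_scope.
Local Open Scope ring_scope.

HB.mixin Record isHilbert (R : realType) V & CompleteNormedModule R V := {
  inner : {dot V for (@idfun R)};
  norm_inner : forall v : V, `|v| ^+ 2 = inner v v
}.

#[short(type="hilbertType")]
HB.structure Definition Hilbert (R : realType) :=
  {V of CompleteNormedModule R V & isHilbert R V}.

Section Dual.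
Context {R : realType} (V : normedModType R).

Definition continuous_functional : {pred V -> R^o} :=
  mem [set f : V -> R^o | linear f /\ continuous f].

Lemma continuous_functional_submod : submod_closed continuous_functional.
Proof.
split=> [|c f g].
  rewrite inE /=; split=> [k x y|]; first by rewrite scaler0 addr0.
  by move=> x; apply: cvg_cst.
rewrite !inE /= => -[lf cf] [lg cg]; split=> [k x y|x].
  rewrite -[LHS]/(c *: f (k *: x + y) + g (k *: x + y)).
  rewrite -[RHS]/(k *: (c *: f x + g x) + (c *: f y + g y)).
  rewrite lf lg !(scalerDr, scalerA) (mulrC k c) -!addrA; congr (_ + _).
  by rewrite addrCA.
by apply: cvgD; [apply: cvgZl_tmp; exact: cf | exact: cg].
Qed.

HB.instance Definition _ :=
  GRing.isSubmodClosed.Build R (V -> R^o) continuous_functional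
    continuous_functional_submod.

Record dual := Dual {
  dual_val :> V -> R^o ;
  dual_valP : dual_val \in continuous_functional }.

HB.instance Definition _ := [isSub for dual_val].
HB.instance Definition _ := [Choice of dual by <:].
HB.instance Definition _ := [SubChoice_isSubLmodule of dual by <:].

Lemma dual_linear (f : dual) : linear f.
Proof. by have := dual_valP f; rewrite inE => -[]. Qed.

HB.instance Definition _ (f : dual) :=
  GRing.isLinear.Build R V R^o _ f (dual_linear f).

Lemma dual_continuous (f : dual) : continuous f.
Proof. by have := dual_valP f; rewrite inE => -[]. Qed.

Lemma dual_has_sup (f : dual) : has_sup [set `|f v| | v in [set v | `|v| <= 1]].
Proof.
split; first by exists `|f 0|, 0 => //=; rewrite normr0.
have /linear_bounded_continuous/bounded_funP/(_ 1)[M fM] := @dual_continuous f.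
by exists M => _ [v /= v1 <-]; exact: fM.
Qed.

Definition dual_norm (f : dual) : R :=
  sup [set `|f v| | v in [set v | `|v| <= 1]].

Lemma dual_norm_ub (f : dual) v : `|v| <= 1 -> `|f v| <= dual_norm f.
Proof.
by move=> v1; apply: ub_le_sup; [exact: (dual_has_sup f).2 | exists v].
Qed.

Lemma dual_norm_le (f : dual) M :
  (forall v, `|v| <= 1 -> `|f v| <= M) -> dual_norm f <= M.
Proof.
move=> fM; apply: ge_sup; first exact: (dual_has_sup f).1.
by move=> _ [v /= v1 <-]; exact: fM.
Qed.

Lemma dual_normD f g : dual_norm (f + g) <= dual_norm f + dual_norm g.
Proof.
apply: dual_norm_le => v v1.
by rewrite (le_trans (ler_normD _ _))// lerD// dual_norm_ub.
Qed.

Lemma dual_normZ_le c f : dual_norm (c *: f) <= `|c| * dual_norm f.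
Proof.
apply: dual_norm_le => v v1.
by rewrite [X in `|X|]/(c * f v) normrM ler_wpM2l// dual_norm_ub.
Qed.

Lemma dual_normZ c f : dual_norm (c *: f) = `|c| * dual_norm f.
Proof.
apply/le_anti; rewrite dual_normZ_le /=.
have [->|c0] := eqVneq c 0.
  by rewrite normr0 mul0r (le_trans _ (@dual_norm_ub _ 0 _)) ?normr0.
rewrite -ler_pdivlMl ?normr_gt0// -normfV.
by rewrite -{1}(scalerK c0 f) dual_normZ_le.
Qed.

Lemma dual_norm0_eq0 f : dual_norm f = 0 -> f = 0.
Proof.
move=> f0; apply/val_inj/funext => v /=; rewrite -[RHS]/(0 : R).
have [->|v0] := eqVneq v 0; first exact: (linear0 f).
have : `|f (`|v|^-1 *: v)| <= dual_norm f.
  by apply: dual_norm_ub; rewrite normrZ normfV normr_id mulVf ?normr_eq0.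
rewrite f0 normr_le0 linearZ/= => /eqP/(congr1 (fun x : R => `|v| * x)).
by rewrite mulr0 [X in _ * X]/(_ * _) mulVKf ?normr_eq0.
Qed.

HB.instance Definition _ :=
  Lmodule_isNormed.Build R dual dual_normD dual_normZ dual_norm0_eq0.

End Dual.

Definition linear_isomorphism (R : realType) (V W : normedModType R)
    (T : V -> W) :=
  linear T /\ continuous T /\
  exists S : W -> V, [/\ cancel T S, cancel S T & continuous S].

Section Form.
Context {R : realType} {V : normedModType R}.

Definition bounded_form (a : {biscalar V}) :=
  exists C : R, forall v w, `|a v w| <= C * `|v| * `|w|.

Lemma form_operator_subproof (a : {biscalar V}) (ha : bounded_form a) (v : V) :
  (a v : V -> R^o) \in @continuous_functional R V.
Proof.
have la : linear (a v : V -> R^o) by move=> c x y; rewrite linearPr.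
rewrite inE /=; split=> //.
pose f : {linear V -> R^o} := HB.pack (a v : V -> R^o)
  (GRing.isLinear.Build _ _ _ _ (a v : V -> R^o) la).
apply: (@bounded_linear_continuous _ _ _ f); apply/bounded_funP => r.
have [C aC] := ha; exists (`|C| * `|v| * r) => w wr.
rewrite (le_trans (aC v w))// (@le_trans _ _ (`|C| * `|v| * `|w|))//.
  by rewrite !ler_wpM2r// ler_norm.
by rewrite ler_wpM2l// mulr_ge0.
Qed.

Definition form_operator (a : {biscalar V}) (ha : bounded_form a) (v : V) :
  dual V := Dual (form_operator_subproof ha v).

Definition inf_sup_stable (a : {biscalar V}) (ha : bounded_form a) :=
  linear_isomorphism (form_operator ha).

Definition finite_dim (W : {pred V}) :=
  exists e : seq V, {subset e <= W} /\
    forall v, v \in W -> exists c : 'I_(size e) -> R, v = \sum_i c i *: e`_i.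

(* An arbitrary norm, not assumed to be equivalent to the Hilbert norm of V. *)
Definition is_norm (N : V -> R) :=
  [/\ forall v w, N (v + w) <= N v + N w,
      forall (c : R) v, N (c *: v) = `|c| * N v
    & forall v, N v = 0 -> v = 0].

(* Extended-real valued: +oo if T is unbounded for N; the supremum is over the
   empty set, hence -oo, exactly when V is the zero space. *)
Definition opnorm (N : V -> R) (T : V -> V) : \bar R :=
  ereal_sup [set (N (T v) / N v)%:E | v in [set v | v != 0]].

Definition contractive_iterator (N : V -> R) (a : {biscalar V})
    (ha : bounded_form a) (B : {linear dual V -> V}) :=
  (opnorm N (fun v => v - B (form_operator ha v))%R < 1)%E.

End Form.

(* Main.v *)
(* With e = u - uh the residual is r = A e, so B r = e - (I - BA) e.  Both
   estimates are the triangle inequality combined with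
   |(I - BA) e|_M <= |I - BA|_M |e|_M and |I - BA|_M < 1. *)

Require Import Defs.
From HB Require Import structures.
From mathcomp Require Import all_boot all_order all_algebra.
From mathcomp Require Import all_classical all_reals all_analysis.

Set Implicit Arguments.
Unset Strict Implicit.
Unset Printing Implicit Defensive.

Import Order.TTheory GRing.Theory Num.Theory.
Import numFieldNormedType.Exports.

Local Open Scope classical_set_scope.
Local Open Scope ring_scope.

(** Since [u] solves the problem, [r = A e] with [e = u - uh], so [e - B r] is the error after one
    iterator step. With [q] the contraction factor, [opnorm_ub] bounds its norm by [q] times that of
    [e], and [opnorm_fine_lt1] gives [q < 1]. Thus [B r] is a perturbation of [e] of relative size
    below 1, and two triangle inequalities compare them. *)

Section NormFacts.
Context {R : realType} {V : normedModType R} (N : V -> R) (N_norm : is_norm N).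

Lemma is_norm0 : N 0 = 0.
Proof. by have [_ NZ _] := N_norm; rewrite -(scale0r 0) NZ normr0 mul0r. Qed.

Lemma is_normN v : N (- v) = N v.
Proof. by have [_ NZ _] := N_norm; rewrite -scaleN1r NZ normrN1 mul1r. Qed.

(** Not an axiom of [is_norm]: it comes from [0 = N (v - v) <= 2 N v]. *)
Lemma is_norm_ge0 v : 0 <= N v.
Proof.
have [ND _ _] := N_norm; have := ND v (- v).
by rewrite subrr is_norm0 is_normN -mulr2n pmulrn_lge0.
Qed.

Lemma is_norm_gt0 v : v != 0 -> 0 < N v.
Proof.
have [_ _ N0] := N_norm.
by move=> v0; rewrite lt_def is_norm_ge0 andbT; apply: contra_neq v0 => /N0.
Qed.

(** The quotient at a nonzero [v] excludes [-oo], the bound by 1 excludes [+oo]. *)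
Lemma opnorm_fine (T : V -> V) (v : V) : v != 0 -> (opnorm N T < 1)%E ->
  (fine (opnorm N T))%:E = opnorm N T.
Proof.
move=> v0 T1; have Tge : ((N (T v) / N v)%:E <= opnorm N T)%E.
  by apply: ereal_sup_ubound; exists v.
by apply: fineK; rewrite fin_numE; case: (opnorm N T) T1 Tge.
Qed.

Lemma opnorm_ub (T : V -> V) (v : V) : v != 0 -> (opnorm N T < 1)%E ->
  N (T v) <= fine (opnorm N T) * N v.
Proof.
move=> v0 T1; rewrite -ler_pdivrMr ?is_norm_gt0// -lee_fin.
by rewrite (opnorm_fine v0 T1); apply: ereal_sup_ubound; exists v.
Qed.

Lemma opnorm_fine_lt1 (T : V -> V) (v : V) : v != 0 -> (opnorm N T < 1)%E ->
  fine (opnorm N T) < 1.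
Proof. by move=> v0 T1; rewrite -lte_fin (opnorm_fine v0 T1). Qed.

End NormFacts.

Theorem theorem2p2 (R : realType) (V : hilbertType R)
    (Vh : {pred V}) (Vh_subspace : submod_closed Vh) (Vh_fin : finite_dim Vh)
    (a : {biscalar V}) (a_bounded : bounded_form a)
    (a_stable : inf_sup_stable a_bounded)
    (f : dual V)
    (u : V) (u_sol : forall v, a u v = f v)
    (uh : V) (uh_in : uh \in Vh)
    (uh_sol : forall vh, vh \in Vh -> a uh vh = f vh)
    (normM : V -> R) (normM_norm : is_norm normM)
    (B : {linear dual V -> V})
    (B_contr : contractive_iterator normM a_bounded B) :
  let A := form_operator a_bounded in
  let r := f - A uh in
  (u != uh -> 2^-1 * normM (B r) < normM (u - uh)) /\
  normM (u - uh) <= normM (B r) / (1 - fine (opnorm normM (fun v => v - B (A v)))).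
Proof.
move=> A r; have [ND _ _] := normM_norm.
have rE : r = A (u - uh).
  apply/val_inj/funext => v; rewrite -[LHS]/(f v - a uh v) -u_sol.
  by rewrite -[RHS]/(a (u - uh) v) linearBl.
(* For zero error the strict bound is vacuous and the other reads [0 <= 0], whatever the
   denominator; this covers [V = 0], where [opnorm] is [-oo]. *)
have [uuh|u_neq] := eqVneq u uh.
  have r0 : r = 0.
    apply/val_inj/funext => v; rewrite -[LHS]/(f v - a uh v) -u_sol uuh.
    exact: subrr.
  by split=> //; rewrite r0 linear0 uuh subrr is_norm0// mul0r.
have e0 : u - uh != 0 by rewrite subr_eq0.
have := opnorm_ub normM_norm e0 B_contr.
have := opnorm_fine_lt1 e0 B_contr.
rewrite -/A -rE; set q := fine _; set e := u - uh in e0 * => q1 Te.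
have e_gt0 := is_norm_gt0 normM_norm e0.
have Te_lt : normM (e - B r) < normM e.
  by rewrite (le_lt_trans Te)// gtr_pMl.
split=> [_|].
  (* Split [B r = e - (e - B r)]: both terms have norm at most that of [e], the second strictly
     less, whence the factor 2. *)
  have := ND e (- (e - B r)); rewrite is_normN// subKr => Br_le.
  by rewrite ltr_pdivrMl// mulr_natl mulr2n (le_lt_trans Br_le)// ltrD2l.
(* Split [e = (e - B r) + B r] and absorb [q * normM e] on the left. *)
have := ND (e - B r) (B r); rewrite subrK => e_le.
rewrite ler_pdivlMr ?subr_gt0// mulrBr mulr1 lerBlDr addrC mulrC.
by rewrite (le_trans e_le)// lerD2r.
Qed.
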